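(* Let $\xi_0<\xi_1$ be real, $\bar\xi=(\xi_0+\xi_1)/2$ and $\delta=\frac{\xi_1-\xi_0}{2}>0$. For any fixed $\theta\in(0,\pi)$ consider $$\gamma(r,\theta)=M(re^{i\theta})=\frac{\xi_0+\xi_1re^{i\theta}}{1+re^{i\theta}},\qquad r\ge0 .$$ Then the image of $[0,\infty)$ under $r\mapsto\gamma(r,\theta)$ is an arc of the unique circle in the Riemann sphere that passes through the three points $\xi_0$, $\xi_1$ and $\bar\xi+i\delta\tan\left(\frac{\theta}{2}\right)$.
   Context: $M(z)=\frac{\xi_0+\xi_1z}{1+z}$ is a Möbius transformation of the extended complex plane $\hat{\mathbb{C}}=\mathbb{C}\cup\{\infty\}$. *)

(* Defs.v *)
(* MathComp world, with MathComp-Analysis and mathcomp-real-closed. *)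
From HB Require Import structures.
From mathcomp Require Import all_boot all_order all_algebra.
From mathcomp Require Export complex.
From mathcomp Require Import all_classical all_reals all_analysis.
Set Implicit Arguments.
Unset Strict Implicit.
Unset Printing Implicit Defensive.
Import Order.TTheory GRing.Theory Num.Theory.
Import numFieldNormedType.Exports.

Local Open Scope classical_set_scope.
Local Open Scope ring_scope.
Local Open Scope complex_scope.

(* [Some z] is the finite point [z] and [None] is the point at infinity.
   [R[i]^o] carries the topology of the modulus. *)
Definition riemann_sphere (R : realType) : topologicalType :=
  one_point_compactification (R[i]^o).

Definition fin_pt (R : realType) (z : R[i]) : riemann_sphere R := Some z.

Definition infty_pt (R : realType) : riemann_sphere R := None.
Arguments infty_pt {R}.

Definition cis (R : realType) (theta : R) : R[i] := cos theta +i* sin theta.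

Definition M (R : realType) (xi0 xi1 : R) (w : riemann_sphere R) :
    riemann_sphere R :=
  if w is Some z then
    if 1 + z == 0 then infty_pt
    else fin_pt ((xi0%:C + xi1%:C * z) / (1 + z))
  else fin_pt xi1%:C.

Definition gamma (R : realType) (xi0 xi1 r theta : R) : riemann_sphere R :=
  M xi0 xi1 (fin_pt (r%:C * cis theta)).

(* A circle in the Riemann sphere is a Euclidean circle of positive radius, or
   a straight line completed by the point at infinity. *)
Definition sphere_circle (R : realType) (K : set (riemann_sphere R)) : Prop :=
  (exists (c : R[i]) (rho : R), 0 < rho /\
     K = [set fin_pt z | z in [set z : R[i] | `|z - c| = rho%:C]]) \/
  (exists a b : R[i], b != 0 /\
     K = range (fun t : R => fin_pt (a + t%:C * b)) `|` [set infty_pt]).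

(* The arcs of a circle are its connected proper subsets with more than one
   point; an arc may contain both, one or none of its endpoints. *)
Definition arc_of (R : realType) (K A : set (riemann_sphere R)) : Prop :=
  [/\ A `<` K, connected A & exists p q, [/\ A p, A q & p <> q]].

(* Main.v *)
Require Import Defs.
From HB Require Import structures.
From mathcomp Require Import all_boot all_order all_algebra.
From mathcomp Require Import all_classical all_reals all_analysis.
From mathcomp Require Import ring lra.
Set Implicit Arguments.
Unset Strict Implicit.
Unset Printing Implicit Defensive.
Import Order.TTheory GRing.Theory Num.Theory.
Import numFieldNormedType.Exports.

Local Open Scope classical_set_scope.
Local Open Scope ring_scope.
Local Open Scope complex_scope.

(** The transformation [M] carries the ray of argument [theta] from [M 0 = xi0]
    towards [M oo = xi1], passing at modulus 1 through
    [M (cis theta) = xibar + i * delta * tan (theta / 2)] ([ray_image1]).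

    Rather than appeal to the general fact that Moebius maps preserve circles,
    one exhibits the center [c = xibar - i * delta * cot theta] and the radius
    [rho = delta / sin theta]. Since [xi0 - c = i * rho * cis theta] and
    [xi1 - c = i * rho * (cis theta)^*], for [z = r * cis theta] the numerator
    of [M z - c] is [i * rho * cis theta * (1 + z)^*] while its denominator is
    [1 + z]; so [|M z - c| = rho] ([ray_image_on_circle]).

    The third point is not real because [0 < tan (theta / 2)], so no line
    contains the three points, and the center of a Euclidean circle through them
    is determined by two linear equations ([sphere_circle_unique]).

    The image is connected, as a continuous image of the half-line
    ([ray_image_continuous]); it misses the point [xi1] of the circle
    ([ray_image_neq_xi1]) and contains the distinct points [xi0] and
    [M (cis theta)]. It is therefore an arc. *)

(** * Circles of the sphere through two real points and a non-real one *)

Lemma complex_ext (R : realType) (z w : R[i]) :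
  complex.Re z = complex.Re w -> complex.Im z = complex.Im w -> z = w.
Proof. by case: z w => [a b] [a' b'] /= -> ->. Qed.

Lemma dist_sqrE (R : realType) (z : R[i]) (rho : R) :
  `|z| = rho%:C -> (complex.Re z) ^+ 2 + (complex.Im z) ^+ 2 = rho ^+ 2.
Proof.
by move=> zrho; apply: complexI; rewrite add_Re2_Im2 zrho rmorphXn.
Qed.

(** Equidistance from the two real points fixes the real part of the center;
    the difference of the squared distances to [x0] and to the non-real point
    [p] is then affine in the imaginary part, with slope [2 * Im p]. *)
Lemma circumcenter_unique (R : realType) (x0 x1 rho rho' : R) (p c c' : R[i]) :
  x0 != x1 -> complex.Im p != 0 ->
  `|x0%:C - c| = rho%:C -> `|x1%:C - c| = rho%:C -> `|p - c| = rho%:C ->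
  `|x0%:C - c'| = rho'%:C -> `|x1%:C - c'| = rho'%:C -> `|p - c'| = rho'%:C ->
  c = c'.
Proof.
case: p c c' => [p q] [a b] [a' b'] /= x01 q0.
move=> /dist_sqrE /= e0 /dist_sqrE /= e1 /dist_sqrE /= ep.
move=> /dist_sqrE /= f0 /dist_sqrE /= f1 /dist_sqrE /= fp.
have aa' : a = a'.
  apply: (mulfI (x := 2 * (x1 - x0))); last lra.
  by rewrite mulf_neq0 ?pnatr_eq0 // subr_eq0 eq_sym.
rewrite -aa' in f0 f1 fp *; congr (_ +i* _).
apply: (mulfI (x := 2 * q)); first by rewrite mulf_neq0 ?pnatr_eq0.
lra.
Qed.

(** A straight line with two points on the real axis is the real axis. *)
Lemma Im_line_through_reals (R : realType) (x0 x1 t0 t1 : R) (a b : R[i]) :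
  x0 != x1 -> a + t0%:C * b = x0%:C -> a + t1%:C * b = x1%:C ->
  forall t : R, complex.Im (a + t%:C * b) = 0.
Proof.
case: a b => [a a'] [b b'] x01 [e0 f0] [e1 f1] t /=.
have b'0 : b' = 0.
  apply: (mulfI (x := t0 - t1)); last lra.
  apply: contra_neq x01 => t01; rewrite -e0 -e1.
  by have -> : t0 = t1 by lra.
by move: f0; rewrite b'0; lra.
Qed.

(** A non-real third point excludes straight lines. *)
Lemma sphere_circleE (R : realType) (K : set (riemann_sphere R)) (x0 x1 : R)
    (p : R[i]) :
  sphere_circle K -> x0 != x1 -> complex.Im p != 0 ->
  K (fin_pt x0%:C) -> K (fin_pt x1%:C) -> K (fin_pt p) ->
  exists (c : R[i]) (rho : R),
    [/\ K = [set fin_pt z | z in [set z : R[i] | `|z - c| = rho%:C]],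
       `|x0%:C - c| = rho%:C, `|x1%:C - c| = rho%:C & `|p - c| = rho%:C].
Proof.
move=> cK x01 p0; case: cK => [[c [rho [_ ->]]]|[a [b [_ ->]]]].
  by move=> [? z0 [<-]] [? z1 [<-]] [? zp [<-]]; exists c, rho.
move=> [[t0 _ [e0]]|//] [[t1 _ [e1]]|//] [[t _ [ep]]|//].
by move: p0; rewrite -ep (Im_line_through_reals x01 e0 e1) eqxx.
Qed.

Lemma sphere_circle_unique (R : realType) (K K' : set (riemann_sphere R))
    (x0 x1 : R) (p : R[i]) :
  x0 != x1 -> complex.Im p != 0 ->
  sphere_circle K -> K (fin_pt x0%:C) -> K (fin_pt x1%:C) -> K (fin_pt p) ->
  sphere_circle K' -> K' (fin_pt x0%:C) -> K' (fin_pt x1%:C) ->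
  K' (fin_pt p) -> K = K'.
Proof.
move=> x01 p0 cK K0 K1 Kp cK' K'0 K'1 K'p.
have [c [rho [-> e0 e1 ep]]] := sphere_circleE cK x01 p0 K0 K1 Kp.
have [c' [rho' [-> f0 f1 fp]]] := sphere_circleE cK' x01 p0 K'0 K'1 K'p.
have cc' := circumcenter_unique x01 p0 e0 e1 ep f0 f1 fp.
by rewrite -cc' in f0 *; rewrite -e0 -f0.
Qed.

(** * The ray and its image *)

(** An error bound [e] in [R[i]] is positive exactly when it is real with
    positive real part, so the embedding of the reals reduces to the real
    estimate for [Re e]. *)
Lemma real_complex_continuous (R : realType) :
  continuous (fun r : R => r%:C : R[i]^o).
Proof.
move=> r; apply/cvgrPdist_lt => e e0.
move: e0; rewrite ltcE /= => /andP[/eqP ime ree].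
near=> t.
rewrite -rmorphB /= normc_def /= expr0n addr0 sqrtr_sqr ltcE /= ime eqxx /=.
near: t.
by apply: (@cvgr_dist_lt _ _ _ _ _ id).
Unshelve. all: by end_near. Qed.

(** The pole [-1] of the transformation lies on the line of argument [theta]
    only if that line is the real axis. *)
Lemma one_plus_ray_neq0 (R : realType) (r theta : R) :
  0 < sin theta -> 1 + r%:C * cis theta != 0.
Proof.
move=> s0; apply/negP => /eqP[re im].
have r0 : r = 0.
  by apply: (mulIf (x := sin theta)); [rewrite gt_eqF | lra].
by move: re; rewrite r0; lra.
Qed.

(** [gamma] with values in the plane, where the algebra and the continuity of
    field operations are available. *)
Definition ray_image (R : realType) (xi0 xi1 theta r : R) : R[i] :=
  (xi0%:C + xi1%:C * (r%:C * cis theta)) / (1 + r%:C * cis theta).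

Lemma gammaE (R : realType) (xi0 xi1 r theta : R) :
  0 < sin theta -> gamma xi0 xi1 r theta = fin_pt (ray_image xi0 xi1 theta r).
Proof.
by move=> s0; rewrite /gamma /M /fin_pt (negbTE (one_plus_ray_neq0 _ s0)).
Qed.

Lemma ray_image_continuous (R : realType) (xi0 xi1 theta : R) :
  0 < sin theta -> continuous (ray_image xi0 xi1 theta : R -> R[i]^o).
Proof.
move=> s0 r.
have ray : {for r, continuous (fun r : R => r%:C * cis theta : R[i]^o)}.
  by apply: cvgMl; exact: real_complex_continuous.
apply: continuousM.
  by apply: cvgD; [exact: cvg_cst | apply: cvgMr].
apply: continuousV; first exact: one_plus_ray_neq0.
by apply: cvgD; [exact: cvg_cst |].
Qed.

(** The value [xi1] is taken by the transformation only at infinity, which the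
    ray approaches without reaching it: the arc is a proper
    subset of its circle. *)
Lemma ray_image_neq_xi1 (R : realType) (xi0 xi1 theta : R) :
  xi0 != xi1 -> 0 < sin theta -> forall r, ray_image xi0 xi1 theta r != xi1%:C.
Proof.
move=> xi01 s0 r; apply: contra_neq xi01 => e.
apply: (@complexI R); have := one_plus_ray_neq0 r s0.
set z := r%:C * _ in e * => z0.
have := congr1 ( *%R^~ (1 + z)) e.
by rewrite /ray_image -/z divfK // mulrDr mulr1 => /addIr.
Qed.

(** * The circle that carries the arc *)

(** By the inscribed angle theorem the chord from [xi0] to [xi1], of half-length
    [delta], is seen from the arc under the angle [pi - theta]; this places the
    center at signed distance [delta * cot theta] below the chord's midpoint and
    gives the radius [delta / sin theta]. *)
Definition arc_center (R : realType) (xi0 xi1 theta : R) : R[i] :=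
  (xi0 + xi1) / 2 -i* ((xi1 - xi0) / 2 * (cos theta / sin theta)).

Definition arc_radius (R : realType) (xi0 xi1 theta : R) : R :=
  (xi1 - xi0) / 2 / sin theta.

Lemma norm_cis (R : realType) (theta : R) : `|cis theta| = 1.
Proof. by rewrite normc_def /= cos2Dsin2 sqrtr1. Qed.

(** With respect to the center, the endpoints of the chord have the conjugate
    directions [cis theta] and [(cis theta)^*] up to a quarter turn; the
    computation of the distance to the center rests on this symmetry. *)
Lemma xi0_sub_center (R : realType) (xi0 xi1 theta : R) : 0 < sin theta ->
  xi0%:C - arc_center xi0 xi1 theta
  = 'i * (arc_radius xi0 xi1 theta)%:C * cis theta.
Proof.
move=> s0; have ns0 : sin theta != 0 by rewrite gt_eqF.
by apply: complex_ext; rewrite /arc_radius /=; field.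
Qed.

Lemma xi1_sub_center (R : realType) (xi0 xi1 theta : R) : 0 < sin theta ->
  xi1%:C - arc_center xi0 xi1 theta
  = 'i * (arc_radius xi0 xi1 theta)%:C * (cis theta)^*%C.
Proof.
move=> s0; have ns0 : sin theta != 0 by rewrite gt_eqF.
by apply: complex_ext; rewrite /arc_radius /=; field.
Qed.

Lemma norm_i_radius (R : realType) (xi0 xi1 theta : R) :
  xi0 < xi1 -> 0 < sin theta ->
  `|'i * (arc_radius xi0 xi1 theta)%:C| = (arc_radius xi0 xi1 theta)%:C.
Proof.
move=> xi01 s0; rewrite normrM !normc_def /= expr0n expr1n add0r sqrtr1 mul1r.
rewrite addr0 sqrtr_sqr ger0_norm // ltW // divr_gt0 //; lra.
Qed.

(** Writing [z = r * cis theta], the displacement from the center is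
    [i * rho * cis theta * (1 + z)^* / (1 + z)], a number of modulus [rho]
    because [1 + z] and its conjugate have the same modulus. *)
Lemma ray_image_on_circle (R : realType) (xi0 xi1 theta r : R) :
  xi0 < xi1 -> 0 < sin theta ->
  `|ray_image xi0 xi1 theta r - arc_center xi0 xi1 theta|
  = (arc_radius xi0 xi1 theta)%:C.
Proof.
move=> xi01 s0; have z0 := one_plus_ray_neq0 r s0.
set c := arc_center _ _ _; set rho := arc_radius _ _ _.
have -> : ray_image xi0 xi1 theta r - c
   = 'i * rho%:C * cis theta * (1 + r%:C * cis theta)^*%C
     / (1 + r%:C * cis theta).
  apply: (canRL (mulfK z0)); rewrite mulrBl divfK //.
  have -> : xi0%:C + xi1%:C * (r%:C * cis theta) - c * (1 + r%:C * cis theta)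
     = (xi0%:C - c) + (xi1%:C - c) * (r%:C * cis theta) by ring.
  rewrite xi0_sub_center // xi1_sub_center // -/rho.
  have -> : (1 + r%:C * cis theta)^*%C = 1 + r%:C * (cis theta)^*%C.
    by apply: complex_ext => /=; ring.
  ring.
by rewrite [LHS]normrM normrV ?unitfE // 2!normrM normcJ norm_cis norm_i_radius
  // mulr1 mulfK // normr_eq0.
Qed.

Lemma ray_image0 (R : realType) (xi0 xi1 theta : R) :
  ray_image xi0 xi1 theta 0 = xi0%:C.
Proof. by rewrite /ray_image mul0r mulr0 !addr0 divr1. Qed.

(** The point of modulus 1 on the ray yields the third point of the circle, by
    the half-angle formula
    [(cis theta - 1) / (cis theta + 1) = i * tan (theta / 2)]. *)
Lemma ray_image1 (R : realType) (xi0 xi1 theta : R) :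
  0 < theta -> theta < pi ->
  ray_image xi0 xi1 theta 1 = ((xi0 + xi1) / 2)%:C
    + 'i * ((xi1 - xi0) / 2)%:C * (tan (theta / 2))%:C.
Proof.
move=> t0 tpi; have s0 : 0 < sin theta by apply: sin_gt0_pi; rewrite t0.
have c0 : cos (theta / 2) != 0.
  by rewrite gt_eqF // cos_gt0_pihalf //; apply/andP; split; lra.
apply: (canLR (mulfK (one_plus_ray_neq0 1 s0))); rewrite rmorph1 !mul1r.
have cE : cos theta = cos (theta / 2) ^+ 2 * 2 - 1.
  by rewrite {1}(_ : theta = theta / 2 *+ 2) ?cos_mulr2n; [ring | field].
have sE : sin theta = cos (theta / 2) * sin (theta / 2) * 2.
  by rewrite {1}(_ : theta = theta / 2 *+ 2) ?sin_mulr2n; [ring | field].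
have s2 := sin2cos2 (theta / 2).
apply: complex_ext; rewrite /= cE sE /tan.
  (* [1 - cos ^ 2] is isolated so that it becomes [sin ^ 2], the only use of
     the Pythagorean identity. *)
  have -> : xi0 + (xi1 * (cos (theta / 2) ^+ 2 * 2 - 1)
      - 0 * (cos (theta / 2) * sin (theta / 2) * 2))
    = (xi0 + xi1) * cos (theta / 2) ^+ 2
      - (xi1 - xi0) * (1 - cos (theta / 2) ^+ 2).
    ring.
  rewrite -s2; field; exact: c0.
field; exact: c0.
Qed.

Theorem lemma5 (R : realType) (xi0 xi1 theta : R) :
  xi0 < xi1 -> 0 < theta -> theta < pi ->
  let xibar : R := (xi0 + xi1) / 2 in
  let delta : R := (xi1 - xi0) / 2 in
  exists2 K : set (riemann_sphere R),
    unique (fun K' : set (riemann_sphere R) =>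
      [/\ sphere_circle K', K' (fin_pt xi0%:C), K' (fin_pt xi1%:C)
        & K' (fin_pt (xibar%:C + 'i * delta%:C * (tan (theta / 2))%:C))]) K
    & arc_of K [set gamma xi0 xi1 r theta | r in [set r : R | 0 <= r]].
Proof.
move=> xi01 t0 tpi xibar delta.
have s0 : 0 < sin theta by apply: sin_gt0_pi; rewrite t0.
have xi01n : xi0 != xi1 by rewrite lt_eqF.
rewrite -(ray_image1 xi0 xi1 t0 tpi).
set p := ray_image xi0 xi1 theta 1.
have p0 : complex.Im p != 0.
  have tan0 : 0 < tan (theta / 2).
    rewrite divr_gt0 ?sin_gt0_pi ?cos_gt0_pihalf //; apply/andP; split; lra.
  rewrite /p ray_image1 //= gt_eqF //.
  have : 0 < (xi1 - xi0) / 2 * tan (theta / 2) by rewrite mulr_gt0 //; lra.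
  lra.
pose c := arc_center xi0 xi1 theta; pose rho := arc_radius xi0 xi1 theta.
pose K : set (riemann_sphere R) :=
  [set fin_pt z | z in [set z : R[i] | `|z - c| = rho%:C]].
have cK : sphere_circle K.
  left; exists c, rho; split => //.
  by rewrite !divr_gt0 // subr_gt0.
have Kray r : K (fin_pt (ray_image xi0 xi1 theta r)).
  by exists (ray_image xi0 xi1 theta r) => //; exact: ray_image_on_circle.
have K0 : K (fin_pt xi0%:C) by rewrite -(ray_image0 xi0 xi1 theta).
have K1 : K (fin_pt xi1%:C).
  exists xi1%:C => //=.
  by rewrite xi1_sub_center // normrM normcJ norm_cis mulr1 norm_i_radius.
exists K.
  split=> [|K' [cK' K'0 K'1 K'p]]; first by split=> //; exact: Kray.
  exact: (sphere_circle_unique xi01n p0 cK K0 K1 (Kray 1) cK' K'0 K'1 K'p).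
split.
- rewrite properEneq; split.
    apply/eqP => AK; have : K (fin_pt xi1%:C) by [].
    rewrite -AK => -[r _]; rewrite gammaE // => /Some_inj /eqP.
    by apply/negP; exact: ray_image_neq_xi1.
  by move=> _ [r _ <-]; rewrite gammaE.
- apply: connected_continuous_connected.
    apply/connected_intervalP => x y /= x0 _ z /andP[xz _].
    exact: le_trans xz.
  apply: continuous_subspaceT.
  rewrite (_ : (fun r => _) = (Some : R[i]^o -> riemann_sphere R)
      \o ray_image xi0 xi1 theta); last by apply/funext => r; exact: gammaE.
  move=> r; apply: continuous_comp; first exact: ray_image_continuous.
  exact: one_point_compactification_some_continuous.
- exists (fin_pt xi0%:C), (fin_pt p); split.
  + by exists 0 => //=; rewrite gammaE // ray_image0.
  + by exists 1 => //=; rewrite gammaE.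
  + by move=> /Some_inj e; move: p0; rewrite -e /= eqxx.
Qed.
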